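(* Let $(X,\nu)$ be a standard Borel space with a non-atomic probability measure $\nu$ and let $k>0$. The measures $\check P_{\alpha,k}$ converge weakly to the quasi-Lebesgue measure $\tilde P_\Gamma$ when $\alpha\to0$.
   Context: $D^+$ is the cone of finite positive discrete measures on $X$, with the $\sigma$-algebra generated by $\eta\mapsto\eta(A)$, $A\subset X$ Borel. For $\alpha\in(0,1)$, $P_\alpha$ is the law on $D^+$ of the standard $\alpha$-stable process on $(X,\nu)$ (Lévy measure $\frac{\alpha}{\Gamma(1-\alpha)}s^{-\alpha-1}ds$, $s>0$), characterized by $\mathbb{E}_\alpha\left[\exp\left(-\int_Xa\,d\eta\right)\right]=\exp\left(-\int_Xa(x)^\alpha\,d\nu(x)\right)$ for measurable $a:X\to\mathbb{R}_+$ with $\int_Xa^\alpha\,d\nu<\infty$. Let $\gamma=k/\alpha^{1/\alpha}$. Let $\tilde P_{\alpha,k}=e^{\gamma^\alpha}P_\alpha$ be the measure with constant density $e^{\gamma^\alpha}$ with respect to $P_\alpha$, and let $\check P_{\alpha,k}$ be the image of $\tilde P_{\alpha,k}$ under $\eta\mapsto\gamma\cdot\eta$. The gamma measure $P_\Gamma$ is the probability law on $D^+$ determined by $\mathbb{E}_\Gamma\left[\exp\left(-\int_X a\,d\eta\right)\right]=\exp\left(-\int_X\log(1+a)\,d\nu\right)$ for every non-negative bounded Borel $a$. The quasi-Lebesgue measure $\tilde P_\Gamma$ is the $\sigma$-finite measure with $\frac{d\tilde P_\Gamma}{dP_\Gamma}(\eta)=\exp(\eta(X))$. Weak convergence here means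 convergence of the Laplace transforms: for every bounded non-negative measurable function $a$ on $X$ with $\int_X|\log a|\,d\nu<\infty$, $\int\exp\left(-\int_Xa\,d\eta\right)d\check P_{\alpha,k}(\eta)\to\int\exp\left(-\int_Xa\,d\eta\right)d\tilde P_\Gamma(\eta)$ as $\alpha\to0$. *)

(* Defs.v *)
From HB Require Import structures.
From mathcomp Require Import all_boot all_order all_algebra.
From mathcomp Require Import all_classical all_reals all_analysis.
From mathcomp Require Import measurable_realfun.

Set Implicit Arguments.
Unset Strict Implicit.
Unset Printing Implicit Defensive.

Import Order.TTheory GRing.Theory Num.Theory.
Import numFieldNormedType.Exports.

Local Open Scope classical_set_scope.
Local Open Scope ring_scope.
Local Open Scope ereal_scope.

(* The measurable sets of X are the Borel sets of a Polish topology on X: that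
   topology is pulled back along the bijection f from a complete separable
   metric space T. *)
Definition standard_borel (R : realType) d (X : measurableType d) : Prop :=
  exists (T : metricType R) (f : X -> T),
    [/\ forall F : set_system T, ProperFilter F -> cauchy F ->
          exists p : T, F --> p,
        exists2 D : set T, countable D & dense D,
        bijective f &
        forall B : set T, measurable (f @^-1` B) <-> <<s open >> B].

Definition nonatomic (R : realType) d (X : measurableType d)
    (nu : {measure set X -> \bar R}) : Prop :=
  forall A, measurable A -> 0 < nu A ->
    exists B, [/\ measurable B, B `<=` A & 0 < nu B < nu A].

(* eta = \sum_i z_i \d_(x_i).  The equation is only required on measurable sets
   because a library measure is arbitrary elsewhere; finite sums, in particular
   the zero measure, are covered by taking z_i = 0. *)
Definition discrete (R : realType) d (X : measurableType d)
    (eta : {measure set X -> \bar R}) : Prop :=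
  exists (x : nat -> X) (z : nat -> {nonneg R}), forall A, measurable A ->
    eta A = \sum_(0 <= i <oo) (z i)%:num%:E * \d_(x i) A.

Section Dplus.
Context (R : realType) d (X : measurableType d).

Record Dplus := MkDplus {
  Dplus_val :> {finite_measure set X -> \bar R} ;
  DplusP : discrete Dplus_val }.

HB.instance Definition _ := gen_eqMixin Dplus.
HB.instance Definition _ := gen_choiceMixin Dplus.

Let discrete_mzero : discrete (mzero : {finite_measure set X -> \bar R}).
Proof.
exists (fun=> point), (fun=> 0%:nng%R) => A _.
by rewrite eseries0// => i _ _; rewrite mul0e.
Qed.

HB.instance Definition _ := isPointed.Build Dplus (MkDplus discrete_mzero).

Definition Dplus_ev (A : set X) (eta : Dplus) : \bar R := eta A.

Definition Dplus_measurable : set_system Dplus :=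
  <<s \bigcup_(A in measurable)
        preimage_set_system [set: Dplus] (Dplus_ev A) measurable >>.

Let Dplus_measurable0 : Dplus_measurable set0.
Proof. exact: sigma_algebra0. Qed.

Let Dplus_measurableC U : Dplus_measurable U -> Dplus_measurable (~` U).
Proof. exact: sigma_algebraC. Qed.

Let Dplus_measurableU (F : (set Dplus)^nat) :
  (forall i, Dplus_measurable (F i)) -> Dplus_measurable (\bigcup_i F i).
Proof. exact: sigma_algebra_bigcup. Qed.

Definition Dplus_display : measure_display. Proof. by constructor. Qed.

HB.instance Definition _ := @isMeasurable.Build Dplus_display Dplus
  Dplus_measurable Dplus_measurable0 Dplus_measurableC Dplus_measurableU.

Lemma measurable_Dplus_ev A : measurable A ->
  measurable_fun [set: Dplus] (Dplus_ev A).
Proof.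
move=> mA; apply: (measurability measurable).
  by rewrite smallest_id//; exact: sigma_algebra_measurable.
apply: subset_trans; last exact: sub_gen_smallest.
exact: (bigcup_sup mA).
Qed.

End Dplus.
Arguments Dplus R {d} X.

Section Dplus_scale.
Context (R : realType) d (X : measurableType d).

Section scale.
Variables (c : {nonneg R}) (eta : Dplus R X).

Definition Dplus_scale_val : set X -> \bar R := mscale c eta.

HB.instance Definition _ := Measure.on Dplus_scale_val.

Let Dplus_scale_fin : fin_num_fun Dplus_scale_val.
Proof.
move=> A mA; rewrite /Dplus_scale_val /mscale fin_numM//.
exact: fin_num_measure.
Qed.

HB.instance Definition _ :=
  Measure_isFinite.Build _ _ _ Dplus_scale_val Dplus_scale_fin.

Let discrete_scale :
  discrete (Dplus_scale_val : {finite_measure set X -> \bar R}).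
Proof.
have [x [z xz]] := DplusP eta.
exists x, (fun i => (c%:num * (z i)%:num)%:nng%R) => A mA.
rewrite /= /Dplus_scale_val /mscale xz// -nneseriesZl//.
  by apply: eq_eseriesr => i _; rewrite EFinM muleA.
by move=> i _; rewrite mule_ge0.
Qed.

Definition Dplus_scale : Dplus R X := MkDplus discrete_scale.

End scale.

Lemma measurable_Dplus_scale c : measurable_fun [set: Dplus R X] (Dplus_scale c).
Proof.
apply: (measurability (\bigcup_(A in measurable)
  preimage_set_system [set: Dplus R X] (Dplus_ev A) measurable)) => //.
move=> _ [_ [A mA [B mB <-] <-]].
rewrite !setTI.
have /(_ measurableT _ mB) : measurable_fun [set: Dplus R X]
    (fun eta => c%:num%:E * Dplus_ev A eta).
  by apply: measurable_funeM; exact: measurable_Dplus_ev.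
by rewrite setTI.
Qed.

End Dplus_scale.

Section laplace.
Context (R : realType) d (X : measurableType d).
Implicit Types (nu : {measure set X -> \bar R}) (a : X -> R).
Implicit Types (Q : {measure set (Dplus R X) -> \bar R}).

Definition laplace Q a : \bar R :=
  \int[Q]_eta expeR (- \int[Dplus_val eta]_x (a x)%:E).

Definition bounded_nonneg a : Prop :=
  [/\ measurable_fun [set: X] a, forall x, (0 <= a x)%R &
      exists M : R, forall x, (a x <= M)%R].

Definition is_stable_law nu (alpha : R) (P : probability (Dplus R X) R) :=
  forall a, measurable_fun [set: X] a -> (forall x, (0 <= a x)%R) ->
    \int[nu]_x (a x `^ alpha)%:E < +oo ->
    laplace P a = expeR (- \int[nu]_x (a x `^ alpha)%:E).

Definition is_gamma_law nu (P : probability (Dplus R X) R) :=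
  forall a, bounded_nonneg a ->
    laplace P a = expeR (- \int[nu]_x (ln (1 + a x))%:E).

(* lne 0 = -oo, whereas ln 0 = 0: the integrability of log a forces a > 0
   nu-almost everywhere. *)
Definition laplace_cvg nu (I : Type) (F : set_system I)
    (Q_ : I -> {measure set (Dplus R X) -> \bar R}) Q :=
  forall a, bounded_nonneg a -> \int[nu]_x `|lne (a x)%:E| < +oo ->
    laplace (Q_ i) a @[i --> F] --> laplace Q a.

End laplace.

Section scaled_stable.
Context (R : realType) d (X : measurableType d).
Variables (k : {posnum R}) (alpha : R) (P : probability (Dplus R X) R).

Definition stable_gamma : R := (k%:num / alpha `^ alpha^-1)%R.

Lemma stable_gamma_ge0 : (0 <= stable_gamma)%R.
Proof. by rewrite divr_ge0// powR_ge0. Qed.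

Definition stable_tilde : {measure set (Dplus R X) -> \bar R} :=
  mscale (NngNum (expR_ge0 (stable_gamma `^ alpha))) P.

Definition stable_check : set (Dplus R X) -> \bar R :=
  pushforward stable_tilde (Dplus_scale (NngNum stable_gamma_ge0)).

Let stable_check0 : stable_check set0 = 0.
Proof. by rewrite /stable_check /pushforward preimage_set0 measure0. Qed.

Let stable_check_ge0 A : 0 <= stable_check A.
Proof. by rewrite /stable_check /pushforward measure_ge0. Qed.

Let stable_check_sigma_additive : semi_sigma_additive stable_check.
Proof.
have mf := @measurable_Dplus_scale R d X (NngNum stable_gamma_ge0).
exact: (@measure_semi_sigma_additive _ _ _
  (pushforward stable_tilde (Dplus_scale (NngNum stable_gamma_ge0)))).
Qed.

HB.instance Definition _ := isMeasure.Build _ _ _ stable_check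
  stable_check0 stable_check_ge0 stable_check_sigma_additive.

End scaled_stable.

Section quasi_lebesgue.
Context (R : realType) d (X : measurableType d).
Variable P : probability (Dplus R X) R.

Definition quasi_lebesgue (A : set (Dplus R X)) : \bar R :=
  \int[P]_(eta in A) expeR (Dplus_val eta [set: X]).

Let quasi_lebesgue0 : quasi_lebesgue set0 = 0.
Proof. exact: integral_set0. Qed.

Let quasi_lebesgue_ge0 A : 0 <= quasi_lebesgue A.
Proof. by apply: integral_ge0 => eta _; exact: expeR_ge0. Qed.

Let quasi_lebesgue_sigma_additive : semi_sigma_additive quasi_lebesgue.
Proof.
apply: semi_sigma_additive_nng_induced => [|eta]; last exact: expeR_ge0.
rewrite (_ : (fun _ => _) =
    EFin \o expR \o (fun eta : Dplus R X => fine (Dplus_ev [set: X] eta))).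
  apply/measurable_EFinP; apply: measurableT_comp => //.
  by apply: measurableT_comp => //; exact: measurable_Dplus_ev.
apply/funext => eta /=; rewrite /Dplus_ev.
by rewrite -[in LHS](@fineK _ (eta [set: X])) ?fin_num_measure.
Qed.

HB.instance Definition _ := isMeasure.Build _ _ _ quasi_lebesgue
  quasi_lebesgue0 quasi_lebesgue_ge0 quasi_lebesgue_sigma_additive.

End quasi_lebesgue.

(* Main.v *)
Require Import Defs.
From HB Require Import structures.
From mathcomp Require Import all_boot all_order all_algebra.
From mathcomp Require Import all_classical all_reals all_analysis.
From mathcomp Require Import measurable_realfun.
From mathcomp Require Import ring.
Import Order.TTheory GRing.Theory Num.Theory.
Import numFieldNormedType.Exports.
Local Open Scope classical_set_scope.
Local Open Scope ring_scope.

(** Both Laplace transforms are explicit, and the statement compares them at a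
    test function [a].  On the stable side the transform is
    [exp (- k^al * \int (a^al - 1) / al dnu)], because the scaling constant
    satisfies [gamma^al = k^al / al] ([laplace_stable_check]).  As [al] tends to
    0, [k^al] tends to 1 and the difference quotient tends to [ln a], dominated
    by a multiple of [|ln a|]; hence the transforms converge to
    [exp (- \int ln a dnu)] ([laplace_stable_check_cvg]).

    It remains to see that the quasi-Lebesgue measure has transform
    [exp (- \int ln a dnu)] as well.  For [a >= 1] this is the gamma law at
    [a - 1], the density [exp (eta X)] being absorbed in the test function
    ([laplace_quasi_lebesgue_ge1]).  For smaller [a] the function [a - 1]
    takes negative values, where the gamma law prescribes nothing directly.
    Instead of continuing analytically, one transfers the formula from the
    stable side, where the transform is known for all [a].  With
    [u = exp (- c * eta X)], the transform at [a] is obtained from those at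
    [a + c], [a + 2c], and so on, by the expansion
    [1 / u = \sum_j (1 - u)^j].  The partial sums only involve the transforms
    already identified, so their integrals converge along the stable processes;
    the remainder after [J] terms is at most [u^-2 / (J + 1)], and the integrals
    of [u^-2], which are the transforms at [a - c], stay bounded along the
    stable processes because they converge
    ([laplace_extension]).  This lowers the admissible functions by [c] at a
    time, down to every function bounded away from 0
    ([laplace_quasi_lebesgue_ge]), and letting [a + 1/n] decrease to [a] gives
    the general case ([laplace_quasi_lebesgueE]). *)

Set Implicit Arguments.
Unset Strict Implicit.
Unset Printing Implicit Defensive.

(** * The geometric expansion of the reciprocal *)

Lemma geometric_sumE (R : pzRingType) (J : nat) (u : R) :
  u * (\sum_(j < J) (1 - u) ^+ j) = 1 - (1 - u) ^+ J.
Proof.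
by rewrite -[RHS]opprB subrX1 addrAC subrr add0r mulNr opprK.
Qed.

Lemma geometric_remainder (R : realFieldType) (J : nat) (u : R) : 0 < u ->
  u^-1 - \sum_(j < J) (1 - u) ^+ j = (1 - u) ^+ J / u.
Proof.
move=> u0; have E : u * \sum_(j < J) (1 - u) ^+ j = 1 - (1 - u) ^+ J.
  by rewrite geometric_sumE.
by apply: (mulfI (lt0r_neq0 u0)); rewrite mulrBr E; field; rewrite gt_eqF.
Qed.

(** Each of the [J + 1] powers [(1 - u) ^+ j], [j <= J], is at least
    [(1 - u) ^+ J], while [u] times their sum is at most 1.  This bounds the
    remainder [(1 - u) ^+ J / u] by [u ^- 2 / J.+1], so that two negative
    powers of [u] control one negative power uniformly. *)
Lemma geometric_tail_le (R : realFieldType) (J : nat) (u : R) :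
  0 < u -> u <= 1 -> (1 - u) ^+ J * u * J.+1%:R <= 1.
Proof.
move=> u0 u1; have v0 : 0 <= 1 - u by rewrite subr_ge0.
have v1 : 1 - u <= 1 by rewrite gerBl ltW.
have E : u * \sum_(j < J.+1) (1 - u) ^+ j = 1 - (1 - u) ^+ J.+1.
  by rewrite geometric_sumE.
apply: (@le_trans _ _ (u * \sum_(j < J.+1) (1 - u) ^+ j)); last first.
  by rewrite E gerBl exprn_ge0.
rewrite [_ * u]mulrC -mulrA ler_wpM2l ?(ltW u0)//.
rewrite mulr_natr -[X in _ *+ X]card_ord -sumr_const.
by apply: ler_sum => j _; apply: ler_wiXn2l => //; rewrite -ltnS.
Qed.

(** * Integration against a density *)

Section density.
Local Open Scope ereal_scope.
Context d (T : measurableType d) (R : realType).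

Import HBNNSimple.

Lemma integral_density (mu nu : {measure set T -> \bar R}) (g : T -> R)
    (f : T -> \bar R) :
  measurable_fun [set: T] g -> (forall x, (0 <= g x)%R) ->
  (forall A, measurable A -> nu A = \int[mu]_(x in A) (g x)%:E) ->
  measurable_fun [set: T] f -> (forall x, 0 <= f x) ->
  \int[nu]_x f x = \int[mu]_x (f x * (g x)%:E).
Proof.
move=> mg g0 nuE mf f0; pose f_ := nnsfun_approx measurableT mf.
have mge : measurable_fun [set: T] (EFin \o g) by exact/measurable_EFinP.
have ge0 x : 0 <= (g x)%:E by rewrite lee_fin.
have mfn n : measurable_fun [set: T] (EFin \o f_ n) by exact/measurable_EFinP.
have f_0 n x : 0 <= (f_ n x)%:E by rewrite lee_fin.
have nd_f x : {homo (fun n => (f_ n x)%:E) : a b / (a <= b)%N >-> a <= b}.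
  by move=> a b ab; rewrite lee_fin; exact/lefP/nd_nnsfun_approx.
have f_f x : (f_ n x)%:E @[n --> \oo] --> f x by exact: cvg_nnsfun_approx.
have simple n : \int[nu]_x (f_ n x)%:E = \int[mu]_x ((f_ n x)%:E * (g x)%:E).
  have mind r : measurable (f_ n @^-1` [set r]) by exact: measurable_funPTI.
  under eq_integral do rewrite fimfunE -fsumEFin//.
  rewrite ge0_integral_fsum//; last 2 first.
    - by move=> r; exact/measurable_EFinP/measurableT_comp.
    - by move=> r x _; rewrite EFinM nnfun_muleindic_ge0.
  under [RHS]eq_integral.
    move=> x _; rewrite fimfunE -fsumEFin// ge0_mule_fsuml; last first.
      by move=> r; rewrite EFinM nnfun_muleindic_ge0.
    over.
  rewrite ge0_integral_fsum//; last 2 first.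
    - move=> r; apply: emeasurable_funM => //.
      exact/measurable_EFinP/measurableT_comp.
    - by move=> r x _; rewrite mule_ge0// EFinM nnfun_muleindic_ge0.
  apply: eq_fsbigr => r; rewrite inE => -[t _ <-]; set r' := f_ n t.
  have r0 : (0 <= r')%R by [].
  under eq_integral do rewrite EFinM.
  rewrite ge0_integralZl_EFin//; last exact/measurable_EFinP.
  rewrite integral_indic// setIT nuE//.
  under [RHS]eq_integral do rewrite EFinM -muleA.
  rewrite ge0_integralZl_EFin//; last 2 first.
    - by move=> x _; rewrite mule_ge0// lee_fin.
    - by apply: emeasurable_funM => //; exact/measurable_EFinP.
  congr (_ * _); rewrite integral_mkcond; apply: eq_integral => x _.
  by rewrite epatch_indic muleC.
have lhs : \int[nu]_x (f_ n x)%:E @[n --> \oo] --> \int[nu]_x f x.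
  rewrite (_ : \int[nu]_x f x = \int[nu]_x limn (fun n => (f_ n x)%:E)).
    exact: cvg_monotone_convergence.
  by apply: eq_integral => x _; apply/esym/cvg_lim.
have rhs : \int[mu]_x ((f_ n x)%:E * (g x)%:E) @[n --> \oo] -->
    \int[mu]_x (f x * (g x)%:E).
  rewrite (_ : \int[mu]_x (f x * (g x)%:E) =
      \int[mu]_x limn (fun n => (f_ n x)%:E * (g x)%:E)).
    apply: cvg_monotone_convergence => //.
    - by move=> n; apply: emeasurable_funM; [exact: mfn|exact: mge].
    - by move=> n x _; exact: mule_ge0.
    - by move=> x _ a b ab; apply: lee_wpmul2r => //; exact: nd_f.
  apply: eq_integral => x _; apply/esym/cvg_lim => //.
  exact: cvgeZr.
move: lhs; under eq_fun do rewrite simple.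
by move=> lhs; exact: (cvg_unique _ lhs rhs).
Qed.
End density.

(** * Negative moments as limits *)

Section moments.
Local Open Scope ereal_scope.
Context d (T : measurableType d) (R : realType).
Variables (w u : T -> R).
Hypothesis mw : measurable_fun [set: T] w.
Hypothesis measurable_u : measurable_fun [set: T] u.
Hypothesis w0 : forall x, (0 <= w x)%R.
Hypothesis u01 : forall x, (0 < u x <= 1)%R.

Let u0 x : (0 < u x)%R. Proof. by have /andP[] := u01 x. Qed.

Let u1 x : (u x <= 1)%R. Proof. by have /andP[] := u01 x. Qed.

Let mwu n : measurable_fun [set: T] (fun x => (w x * u x ^+ n)%:E).
Proof.
by apply/measurable_EFinP/measurable_funM => //; exact: measurable_funX.
Qed.

Lemma integral_poly_moments (la : {measure set T -> \bar R}) (p : {poly R})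
    (m : nat -> R) :
  (forall n, (n < size p)%N -> \int[la]_x (w x * u x ^+ n)%:E = (m n)%:E) ->
  \int[la]_x (w x * p.[u x])%:E = (\sum_(n < size p) p`_n * m n)%:E.
Proof.
move=> Hm.
have iwu n : (n < size p)%N ->
    la.-integrable [set: T] (fun x => (w x * u x ^+ n)%:E).
  move=> np; apply/integrableP; split => //.
  under eq_integral.
    move=> x _; rewrite gee0_abs ?lee_fin ?mulr_ge0 ?exprn_ge0 ?(ltW (u0 x))//.
    over.
  by rewrite Hm// ltry.
transitivity (\int[la]_x \sum_(n < size p) ((p`_n)%:E * (w x * u x ^+ n)%:E)).
  apply: eq_integral => x _; rewrite horner_coef mulr_sumr -sumEFin.
  by apply: eq_bigr => n _; rewrite -EFinM mulrCA.
rewrite integral_sum//; last by move=> n; exact/integrableZl/iwu.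
rewrite -sumEFin; apply: eq_bigr => n _.
by rewrite integralZl ?Hm// iwu.
Qed.

Lemma cvg_integral_poly (I : Type) (F : set_system I) {FF : Filter F}
    (la : I -> {measure set T -> \bar R}) (p : {poly R}) (m : nat -> R) :
  (forall n, \int[la i]_x (w x * u x ^+ n)%:E @[i --> F] --> (m n)%:E) ->
  \int[la i]_x (w x * p.[u x])%:E @[i --> F] -->
    (\sum_(n < size p) p`_n * m n)%:E.
Proof.
move=> cm; pose m_ i n := fine (\int[la i]_x (w x * u x ^+ n)%:E).
have fm : \forall i \near F, forall n, (n < size p)%N ->
    \int[la i]_x (w x * u x ^+ n)%:E = (m_ i n)%:E.
  have : \forall i \near F, forall n : 'I_(size p),
      \int[la i]_x (w x * u x ^+ n)%:E = (m_ i n)%:E.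
    apply: filter_forall => n; have /fine_cvgP[fn _] := cm n.
    by near=> i; rewrite fineK//; near: i.
  by apply: filterS => i Hi n np; exact: (Hi (Ordinal np)).
apply: (@cvg_trans _ ((\sum_(n < size p) p`_n * m_ i n)%:E @[i --> F])).
  apply: near_eq_cvg; near=> i; apply/esym/integral_poly_moments.
  by near: i.
apply: cvg_EFin; first exact: nearW.
apply: cvg_big => [|n _]; first exact: add_continuous.
apply: cvgM; first exact: cvg_cst.
by have /fine_cvgP[] := cm n.
Unshelve. all: by end_near. Qed.

(** Moments of nonnegative order determine, in the limit, the moment of order
    [-1].  Expanding [u^-1] into the geometric series of [1 - u], every partial
    sum is a polynomial in [u], whose integral passes to the limit; the
    remainder is at most [u ^- 2 / J.+1], hence negligible uniformly along [F]
    because of the bound [C].  Monotone convergence sums the series under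
    [la]. *)
Lemma integral_reciprocal_cvg (I : topologicalType) (F : set_system I)
    {FF : ProperFilter F} (la_ : I -> {measure set T -> \bar R})
    (la : {measure set T -> \bar R}) (m : nat -> R) (c C : R) :
  (forall n, \int[la_ i]_x (w x * u x ^+ n)%:E @[i --> F] --> (m n)%:E) ->
  (forall n, \int[la]_x (w x * u x ^+ n)%:E = (m n)%:E) ->
  \int[la_ i]_x (w x / u x)%:E @[i --> F] --> c%:E ->
  (\forall i \near F, \int[la_ i]_x (w x / u x ^+ 2)%:E <= C%:E) ->
  \int[la]_x (w x / u x)%:E = c%:E.
Proof.
move=> cm Em cc bC.
pose p J : {poly R} := (\sum_(j < J) (1 - 'X) ^+ j)%R.
have pE J x : ((p J).[u x] = \sum_(j < J) (1 - u x) ^+ j)%R.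
  rewrite horner_sum; apply: eq_bigr => j _.
  by rewrite horner_exp hornerD hornerN hornerX hornerC.
have p0 J x : (0 <= (p J).[u x])%R.
  by rewrite pE; apply: sumr_ge0 => j _; rewrite exprn_ge0// subr_ge0.
have wpu_ge0 J x : 0 <= (w x * (p J).[u x])%:E.
  by rewrite lee_fin mulr_ge0.
have mu1 : measurable_fun [set: T] (fun x => (u x)^-1)%R.
  under eq_fun do rewrite -powR_inv1 ?(ltW (u0 _))//.
  exact: (measurableT_comp (measurable_powR _) measurable_u).
have mwpu J : measurable_fun [set: T] (fun x => (w x * (p J).[u x])%:E).
  apply/measurable_EFinP/measurable_funM => //.
  under eq_fun do rewrite pE.
  apply: measurable_sum => j; apply: measurable_funX.
  exact: measurable_funB.
have mwu1 : measurable_fun [set: T] (fun x => (w x / u x)%:E).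
  by apply/measurable_EFinP/measurable_funM.
have mwu2 : measurable_fun [set: T] (fun x => (w x / u x ^+ 2)%:E).
  under eq_fun do rewrite -exprVn.
  by apply/measurable_EFinP/measurable_funM => //; exact: measurable_funX.
have wu1_ge0 x : (0 <= w x / u x)%R by rewrite divr_ge0// ltW.
have wu2_ge0 x : (0 <= w x / u x ^+ 2)%R by rewrite divr_ge0// exprn_ge0// ltW.
have lo J x : (w x * (p J).[u x] <= w x / u x)%R.
  rewrite ler_wpM2l// -subr_ge0 pE geometric_remainder// divr_ge0//.
    by rewrite exprn_ge0// subr_ge0.
  exact: ltW.
have hi J x : (w x / u x <=
    w x * (p J).[u x] + (J.+1%:R)^-1 * (w x / u x ^+ 2))%R.
  rewrite -lerBlDl -mulrBr pE geometric_remainder// [leRHS]mulrCA ler_wpM2l//.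
  rewrite -ler_pdivrMr ?invr_gt0 ?exprn_gt0// invrK -[leRHS]mul1r.
  rewrite ler_pdivlMr ?ltr0n//.

  rewrite (_ : _ / u x * _ = (1 - u x) ^+ J * u x)%R; last first.
    by field; rewrite gt_eqF.
  exact: geometric_tail_le.
pose s J := (\sum_(n < size (p J)) (p J)`_n * m n)%R.
have lim_s J :
    \int[la_ i]_x (w x * (p J).[u x])%:E @[i --> F] --> (s J)%:E.
  exact: cvg_integral_poly.
have sE J : \int[la]_x (w x * (p J).[u x])%:E = (s J)%:E.
  exact: integral_poly_moments.
have s_le_c J : (s J <= c)%R.
  rewrite -lee_fin; apply: (lee_cvg_to (lim_s J) cc _).
  apply: nearW => i; apply: ge0_le_integral => //.
  by move=> x _; rewrite lee_fin.
have c_le_s J : (c <= s J + J.+1%:R^-1 * C)%R.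
  rewrite -lee_fin EFinD.
  have cs : \int[la_ i]_x (w x * (p J).[u x])%:E + (J.+1%:R^-1 * C)%:E
      @[i --> F] --> (s J)%:E + (J.+1%:R^-1 * C)%:E.
    by apply: cvgeD => //; exact: cvg_cst.
  apply: (lee_cvg_to cc cs _).
  apply: filterS bC => i Ci.
  apply: (@le_trans _ _ (\int[la_ i]_x ((w x * (p J).[u x])%:E +
      (J.+1%:R^-1)%:E * (w x / u x ^+ 2)%:E))).
    apply: ge0_le_integral => //.
    - by move=> x _; rewrite lee_fin; exact: wu1_ge0.
    - by apply: emeasurable_funD => //; exact: measurable_funeM.
    - by move=> x _; rewrite -EFinM -EFinD lee_fin.
  rewrite ge0_integralD//; last 2 first.
  - by move=> x _; rewrite mule_ge0// lee_fin.
  - exact: measurable_funeM.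
  rewrite leeD2l// ge0_integralZl_EFin//; last by move=> x _; rewrite lee_fin.
  by rewrite EFinM lee_wpmul2l// lee_fin.
have sc : s J @[J --> \oo] --> c.
  have lb : (c - C * harmonic J)%R @[J --> \oo] --> c.
    have CH : (C * harmonic J)%R @[J --> \oo] --> (C * 0)%R.
      by apply: cvgM; [exact: cvg_cst|exact: cvg_harmonic].
    have := cvgB (cvg_cst c) CH; rewrite mulr0 subr0; exact.
  apply: (squeeze_cvgr _ lb (cvg_cst c)); apply: nearW => J.
  by rewrite s_le_c andbT lerBlDr mulrC.
(* the partial sums increase to w / u, so s J also tends to its integral *)
have sI : (s J)%:E @[J --> \oo] --> \int[la]_x (w x / u x)%:E.
  under eq_fun do rewrite -sE.
  rewrite (_ : \int[la]_x (w x / u x)%:E =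
      \int[la]_x limn (fun J => (w x * (p J).[u x])%:E)).
    apply: cvg_monotone_convergence => //.
    move=> x _ J K JK; rewrite lee_fin ler_wpM2l// !pE.
    rewrite -(subnKC JK) big_split_ord/= lerDl sumr_ge0// => j _.
    by rewrite exprn_ge0// subr_ge0.
  apply: eq_integral => x _; apply/esym/cvg_lim => //.
  apply: cvg_EFin; first exact: nearW.
  apply: cvgM; first exact: cvg_cst.
  have q1 : (`|1 - u x| < 1)%R.
    by rewrite ger0_norm ?subr_ge0// ltrBlDr ltrDl.
  have := cvg_geometric_series (a := 1%R) q1.
  rewrite subKr mul1r; apply: cvg_trans.
  apply: near_eq_cvg; apply: nearW => J.
  rewrite pE /geometric /series/= big_mkord.
  by apply: eq_bigr => j _; rewrite mul1r.
apply/(cvg_unique _ sI) => //.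
by apply: cvg_EFin => //; exact: nearW.
Unshelve. all: by end_near. Qed.
End moments.

(** * Laplace transforms at bounded test functions *)

Section bounded.
Context (R : realType) d (X : measurableType d).
Implicit Types (a b : X -> R) (c : R).

Lemma bounded_nonneg_cst c : 0 <= c -> bounded_nonneg (fun _ : X => c).
Proof. by move=> c0; split => //; exists c. Qed.

Lemma bounded_nonnegD a b : bounded_nonneg a -> bounded_nonneg b ->
  bounded_nonneg (fun x => a x + b x).
Proof.
move=> [ma a0 [M aM]] [mb b0 [N bN]]; split.
- exact: measurable_funD.
- by move=> x; rewrite addr_ge0.
- by exists (M + N) => x; rewrite lerD.
Qed.

Lemma bounded_nonnegB a c : bounded_nonneg a -> 0 <= c ->
  (forall x, c <= a x) -> bounded_nonneg (fun x => a x - c).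
Proof.
move=> [ma a0 [M aM]] c0 ca; split.
- exact: measurable_funB.
- by move=> x; rewrite subr_ge0.
- by exists M => x; rewrite (le_trans _ (aM x))// gerBl.
Qed.

Lemma bounded_nonneg_scale a c : bounded_nonneg a -> 0 <= c ->
  bounded_nonneg (fun x => c * a x).
Proof.
move=> [ma a0 [M aM]] c0; split.
- exact: measurable_funM.
- by move=> x; rewrite mulr_ge0.
- by exists (c * M) => x; rewrite ler_wpM2l.
Qed.

Lemma bounded_nonneg_powR a c : bounded_nonneg a -> 0 <= c ->
  bounded_nonneg (fun x => a x `^ c).
Proof.
move=> [ma a0 [M aM]] c0; split.
- exact: (measurableT_comp (measurable_powR _) ma).
- by move=> x; exact: powR_ge0.
- exists (M `^ c) => x; apply: ge0_ler_powR => //; rewrite nnegrE//.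
  exact: le_trans (aM x).
Qed.

End bounded.

Section laplace_weight.
Local Open Scope ereal_scope.
Context (R : realType) d (X : measurableType d).
Implicit Types (a b : X -> R) (c : R) (eta : Dplus R X).
Implicit Types (Q : {measure set (Dplus R X) -> \bar R}).

Lemma bounded_nonneg_integrable (mu : {finite_measure set X -> \bar R}) a :
  bounded_nonneg a -> mu.-integrable [set: X] (EFin \o a).
Proof.
move=> [ma a0 [M aM]]; apply: measurable_bounded_integrable => //.
  by rewrite ltey_eq fin_num_measure.
exists M; split; first exact: num_real.
move=> t Mt x _ /=; rewrite ger0_norm//.
exact: le_trans (aM x) (ltW Mt).
Qed.

Lemma measurable_Dplus_integral a : bounded_nonneg a ->
  measurable_fun [set: Dplus R X] (fun eta => \int[Dplus_val eta]_x (a x)%:E).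
Proof.
move=> [ma a0 _].
apply: (@measurable_fun_integral_kernel _ _ _ _ _ (fun eta : Dplus R X =>
  (Dplus_val eta : {measure set X -> \bar R})) _ (EFin \o a)).
- by move=> U mU; exact: measurable_Dplus_ev.
- by move=> x; rewrite lee_fin.
- exact/measurable_EFinP.
Qed.

(** Against a bounded function the integral is finite, so the integrand of the
    Laplace transform can be kept real-valued. *)
Definition laplace_weight a eta : R :=
  expR (- fine (\int[Dplus_val eta]_x (a x)%:E)).

Lemma laplace_weightE a eta : bounded_nonneg a ->
  expeR (- \int[Dplus_val eta]_x (a x)%:E) = (laplace_weight a eta)%:E.
Proof.
move=> ba; have /integrable_fin_num fa := bounded_nonneg_integrable eta ba.
by rewrite /laplace_weight -(fineK (fa measurableT)).
Qed.

Lemma measurable_laplace_weight a : bounded_nonneg a ->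
  measurable_fun [set: Dplus R X] (laplace_weight a).
Proof.
move=> ba; apply: measurableT_comp => //; apply: measurableT_comp => //.
by apply: measurableT_comp => //; exact: measurable_Dplus_integral.
Qed.

Lemma laplace_weight_gt0 a eta : (0 < laplace_weight a eta)%R.
Proof. exact: expR_gt0. Qed.

Lemma laplace_weight_le1 a eta :
  bounded_nonneg a -> (laplace_weight a eta <= 1)%R.
Proof.
move=> [_ a0 _]; rewrite expR_le1 oppr_le0 fine_ge0// integral_ge0// => x _.
by rewrite lee_fin.
Qed.

Lemma laplace_weightD a b eta : bounded_nonneg a -> bounded_nonneg b ->
  laplace_weight (fun x => a x + b x)%R eta =
  (laplace_weight a eta * laplace_weight b eta)%R.
Proof.
move=> ba bb; rewrite /laplace_weight.
have ia := bounded_nonneg_integrable eta ba.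
have ib := bounded_nonneg_integrable eta bb.
rewrite (_ : \int[Dplus_val eta]_x (a x + b x)%:E =
    \int[Dplus_val eta]_x (a x)%:E + \int[Dplus_val eta]_x (b x)%:E).
  rewrite fineD; last 2 first.
  - exact: (integrable_fin_num measurableT ia).
  - exact: (integrable_fin_num measurableT ib).
  by rewrite opprD expRD.
by under eq_integral do rewrite EFinD; rewrite integralD.
Qed.

Lemma laplace_weight_cst c eta :
  laplace_weight (fun=> c) eta = expR (- (c * fine (Dplus_val eta [set: X]))).
Proof. by rewrite /laplace_weight integral_cst// fineM// fin_num_measure. Qed.

Lemma laplaceE Q a : bounded_nonneg a ->
  laplace Q a = \int[Q]_eta (laplace_weight a eta)%:E.
Proof. by move=> ba; apply: eq_integral => eta _; rewrite laplace_weightE. Qed.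

Lemma laplace_weight_iter a c eta n : bounded_nonneg a -> (0 <= c)%R ->
  laplace_weight (fun x => a x + n%:R * c)%R eta =
  (laplace_weight a eta * laplace_weight (fun=> c) eta ^+ n)%R.
Proof.
move=> ba c0; elim: n => [|n IH].
  by rewrite expr0 mulr1; under eq_fun do rewrite mul0r addr0.
under eq_fun do rewrite -natr1 mulrDl mul1r addrA.
rewrite laplace_weightD//; last exact: bounded_nonneg_cst.
  by rewrite IH exprSr mulrA.
by apply: bounded_nonnegD => //; apply: bounded_nonneg_cst; rewrite mulr_ge0.
Qed.

Lemma laplace_weight_sub a c eta n : bounded_nonneg a -> (0 <= c)%R ->
  (forall x, n%:R * c <= a x)%R ->
  laplace_weight (fun x => a x - n%:R * c)%R eta =
  (laplace_weight a eta / laplace_weight (fun=> c) eta ^+ n)%R.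
Proof.
move=> ba c0 ca; have nc0 : (0 <= n%:R * c)%R by rewrite mulr_ge0.
have aE : a = (fun x => a x - n%:R * c + n%:R * c)%R.
  by apply/funext => x; rewrite subrK.
rewrite [X in (laplace_weight X _ / _)%R]aE.
rewrite laplace_weight_iter//; last exact: bounded_nonnegB.
by rewrite mulfK// expf_neq0// gt_eqF// laplace_weight_gt0.
Qed.

(** Downward extension of a Laplace transform.  Write [u] for the Laplace weight
    of the constant [c]: adding [c] to the test function multiplies its weight
    by [u], so the transform at [a] is a moment of order [-1] relative to those
    at [a + n.+1 * c], and the transform at [a - c], of order [-2], bounds the
    remainder. *)
Lemma laplace_extension (I : topologicalType) (F : set_system I)
    {FF : ProperFilter F} (Q_ : I -> {measure set (Dplus R X) -> \bar R}) Q
    (a : X -> R) (c l l' : R) (m : nat -> R) :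
  (0 < c)%R -> bounded_nonneg a -> (forall x, 2 * c <= a x)%R ->
  (forall n, laplace (Q_ i) (fun x => a x + n.+1%:R * c)%R @[i --> F] -->
    (m n)%:E) ->
  (forall n, laplace Q (fun x => a x + n.+1%:R * c)%R = (m n)%:E) ->
  laplace (Q_ i) a @[i --> F] --> l%:E ->
  laplace (Q_ i) (fun x => a x - c)%R @[i --> F] --> l'%:E ->
  laplace Q a = l%:E.
Proof.
move=> c0 ba ca Hm Em Hl Hl'.
have bD n : bounded_nonneg (fun x => a x + n%:R * c)%R.
  apply: bounded_nonnegD => //; apply: bounded_nonneg_cst.
  by rewrite mulr_ge0// ltW.
have ac x : (c <= a x)%R by rewrite (le_trans _ (ca x))// ler_peMl ?ltW// ltr1n.
have bB : bounded_nonneg (fun x => a x - c)%R.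
  by apply: bounded_nonnegB => //; exact: ltW.
pose w := laplace_weight (fun x => a x + c)%R.
pose u := laplace_weight (fun _ : X => c).
have uc : bounded_nonneg (fun _ : X => c).
  by apply: bounded_nonneg_cst; exact: ltW.
have wE : w = (fun eta => laplace_weight a eta * u eta)%R.
  by apply/funext => eta; rewrite /w laplace_weightD.
have wu n : (fun eta => (w eta * u eta ^+ n)%:E) =
    (fun eta => (laplace_weight (fun x => a x + n.+1%:R * c)%R eta)%:E).
  apply/funext => eta; rewrite wE laplace_weight_iter ?(ltW c0)//.
  by rewrite exprS mulrA.
have u_neq0 eta : (u eta != 0)%R by rewrite gt_eqF// laplace_weight_gt0.
have w1 : (fun eta => (w eta / u eta)%:E) =
    (fun eta => (laplace_weight a eta)%:E).
  by apply/funext => eta; rewrite wE mulfK.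
have w2 : (fun eta => (w eta / u eta ^+ 2)%:E) =
    (fun eta => (laplace_weight (fun x => a x - c)%R eta)%:E).
  apply/funext => eta; have := @laplace_weight_sub a c eta 1 ba (ltW c0).
  rewrite mul1r => ->//; by rewrite wE expr1 expr2 invfM mulrA mulfK.
rewrite laplaceE// -w1.
apply: (@integral_reciprocal_cvg _ _ _ w u _ _ _ _ _ F _ Q_ Q m l (l' + 1)%R).
- by apply: measurable_laplace_weight; exact: bounded_nonnegD.
- exact: measurable_laplace_weight.
- by move=> eta; exact/ltW/laplace_weight_gt0.
- by move=> eta; rewrite laplace_weight_gt0 laplace_weight_le1.
- move=> n; rewrite wu; apply: cvg_trans (Hm n); apply: near_eq_cvg.
  by apply: nearW => i; exact: laplaceE.
- by move=> n; rewrite wu -laplaceE.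
- rewrite w1; apply: cvg_trans Hl; apply: near_eq_cvg.
  by apply: nearW => i; exact: laplaceE.
- rewrite w2; have /fine_cvgP[fl cl] := Hl'.
  have l'1 : (l' < l' + 1)%R by rewrite ltrDl.
  have bl := cvgr_le _ cl _ l'1.
  near=> i; rewrite -laplaceE// -[leLHS]fineK; last by near: i.
  rewrite lee_fin; near: i; exact: bl.
Unshelve. all: by end_near. Qed.

End laplace_weight.

(** * The difference quotient of a power at exponent 0 *)

Lemma powR_sub1_div_ge (R : realType) (x s : R) : 0 < x -> 0 < s ->
  ln x <= (x `^ s - 1) / s.
Proof.
move=> x0 s0; rewrite ler_pdivlMr// lerBrDl /powR gt_eqF// mulrC.
exact: expR_ge1Dx.
Qed.

Lemma powR_sub1_div_le (R : realType) (x s : R) : 0 < x -> 0 < s ->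
  (x `^ s - 1) / s <= ln x * x `^ s.
Proof.
move=> x0 s0; rewrite ler_pdivrMr// lerBlDl -lerBlDr.
have -> : x `^ s - ln x * x `^ s * s = (1 + (- (s * ln x))) * x `^ s by ring.
rewrite /powR gt_eqF// -[leRHS](expRxMexpNx_1 (s * ln x)) mulrC.
by rewrite ler_wpM2l ?expR_ge0// expR_ge1Dx.
Qed.

Lemma powR_le_bound (R : realType) (x M s : R) : 0 < x -> x <= M -> 1 <= M ->
  0 <= s -> s <= 1 -> x `^ s <= M.
Proof.
move=> x0 xM M1 s0 s1; apply: (@le_trans _ _ (M `^ s)).
  by apply: ge0_ler_powR; rewrite ?nnegrE// ltW// (lt_le_trans x0).
exact: ler1_powR.
Qed.

(** The domination, uniform in [s], under which the limit [s --> 0] is taken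
    inside the integral. *)
Lemma norm_powR_sub1_div_le (R : realType) (x M s : R) :
  0 < x -> x <= M -> 1 <= M -> 0 < s -> s <= 1 ->
  `|(x `^ s - 1) / s| <= M * `|ln x|.
Proof.
move=> x0 xM M1 s0 s1.
have xs := powR_le_bound x0 xM M1 (ltW s0) s1.
have lM : `|ln x| <= M * `|ln x| by rewrite ler_peMl.
rewrite ler_norml; apply/andP; split.
  apply: le_trans (powR_sub1_div_ge x0 s0).
  apply: (@le_trans _ _ (- `|ln x|)); first by rewrite lerN2.
  by rewrite lerNl -normrN ler_norm.
apply: (le_trans (powR_sub1_div_le x0 s0)).
apply: (le_trans (ler_norm _)); rewrite normrM mulrC.
by rewrite ler_wpM2r// ger0_norm// powR_ge0.
Qed.

Lemma cvg_powR_at0 (R : realType) (x : R) : 0 < x ->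
  x `^ s @[s --> 0^'+] --> (1 : R).
Proof.
move=> x0; rewrite -(powRr0 x); apply: cvg_at_right_filter.
rewrite /powR gt_eqF//; apply: continuous_comp; last exact: continuous_expR.
by apply: cvgM; [exact: cvg_id|exact: cvg_cst].
Qed.

Lemma cvg_powR_sub1_div (R : realType) (x : R) : 0 < x ->
  (x `^ s - 1) / s @[s --> 0^'+] --> ln x.
Proof.
move=> x0.
have c1 : ln x * x `^ s @[s --> 0^'+] --> ln x.
  by have := cvgM (cvg_cst (ln x)) (cvg_powR_at0 x0); rewrite mulr1; apply.
apply: (squeeze_cvgr _ (cvg_cst (ln x)) c1).
near=> s; have s0 : 0 < s by near: s; exact: nbhs_right_gt.
by rewrite powR_sub1_div_ge// powR_sub1_div_le.
Unshelve. all: by end_near. Qed.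

(** * Passing to the logarithm under the integral *)

Section log_limit.
Local Open Scope ereal_scope.
Context (R : realType) d (X : measurableType d) (nu : probability X R).
Variable a : X -> R.
Hypothesis ba : bounded_nonneg a.
Hypothesis la : \int[nu]_x `|lne (a x)%:E| < +oo.

Let ma : measurable_fun [set: X] a. Proof. by have [] := ba. Qed.
Let a0 x : (0 <= a x)%R. Proof. by have [] := ba. Qed.

Let mln : measurable_fun [set: X] (fun x => ln (a x)).
Proof. exact: (measurableT_comp (@measurable_ln R) ma). Qed.

Let mlne : measurable_fun [set: X] (fun x => lne (a x)%:E).
Proof.
rewrite (_ : (fun _ => _) =
    (fun x => if (a x <= 0)%R then -oo else (ln (a x))%:E)).
  apply: measurable_fun_ifT => //; last exact/measurable_EFinP.
  exact: measurable_fun_ler.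
apply/funext => x; case: ifPn => [x0|]; first by rewrite le0_lneNy.
by rewrite -ltNge => x0; rewrite lne_EFin.
Qed.

(** [lne] is infinite at 0, so its integrability excludes the zeros of [a] up to
    a null set. *)
Lemma ae_pos_of_integrable_ln : {ae nu, forall x, (0 < a x)%R}.
Proof.
have il : nu.-integrable [set: X] (fun x => lne (a x)%:E).
  by apply/integrableP; split.
have := integrable_ae measurableT il.
apply: filterS => x /(_ Logic.I); rewrite ltNge; apply: contraL => ax.
by rewrite le0_lneNy.
Qed.

Lemma integrable_ln : nu.-integrable [set: X] (fun x => (ln (a x))%:E).
Proof.
apply/integrableP; split; first exact/measurable_EFinP.
apply: le_lt_trans la; apply: ge0_le_integral => //.
- by do 2 apply: measurableT_comp => //.
- exact: measurableT_comp.
- move=> x _; have := a0 x; rewrite le_eqVlt => /predU1P[<-|ax].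
    by rewrite ln0// abse0.
  by rewrite lne_EFin.
Qed.

Lemma cvg_integral_powR_ln :
  \int[nu]_x ((a x `^ s - 1) / s)%:E @[s --> 0^'+] --> \int[nu]_x (ln (a x))%:E.
Proof.
have fl := integrable_fin_num measurableT integrable_ln.
rewrite -(fineK fl); apply/cvge_at_rightP => s_ [s0 s_cvg]; rewrite fineK//.
(* the domination holds for exponents at most 1: the sequence is shifted *)
have [N _ sN] : \forall n \near \oo, (s_ n <= 1)%R.
  exact: (cvgr_le _ s_cvg).
rewrite -(cvg_shiftn N).
have [_ _ [M' aM']] := ba.
pose M := Num.max 1%R M'.
have M1 : (1 <= M)%R by rewrite le_max lexx.
have aM x : (a x <= M)%R by rewrite le_max aM' orbT.
have mf n : measurable_fun [set: X]
    (fun x => ((a x `^ s_ (n + N)%N - 1) / s_ (n + N)%N)%:E).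
  apply/measurable_EFinP/measurable_funM => //; apply: measurable_funB => //.
  exact: (measurableT_comp (measurable_powR _) ma).
have [] := @dominated_convergence _ _ _ nu _ measurableT
  (fun n x => ((a x `^ s_ (n + N)%N - 1) / s_ (n + N)%N)%:E)
  (fun x => (ln (a x))%:E) (fun x => M%:E * `|(ln (a x))%:E|) mf.
- exact/measurable_EFinP.
- apply: filterS ae_pos_of_integrable_ln => x ax _.
  apply: cvg_EFin; first exact: nearW.
  have := (cvg_at_rightP _ _ _).1 (cvg_powR_sub1_div ax) s_ (conj s0 s_cvg).
  by rewrite -(cvg_shiftn N).
- by apply: integrableZl => //; apply: integrable_abse; exact: integrable_ln.
- apply: filterS ae_pos_of_integrable_ln => x ax n _.
  rewrite -EFinM lee_fin; apply: norm_powR_sub1_div_le => //.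
  by apply: sN => /=; exact: leq_addl.
- by [].
Qed.

Lemma cvg_integral_ln_add :
  \int[nu]_x (ln (a x + n.+1%:R^-1))%:E @[n --> \oo] -->
    \int[nu]_x (ln (a x))%:E.
Proof.
have [_ _ [M aM]] := ba.
have mf n : measurable_fun [set: X] (fun x => (ln (a x + n.+1%:R^-1))%:E).
  apply/measurable_EFinP; apply: (measurableT_comp (@measurable_ln R)).
  exact: measurable_funD.
have [] := @dominated_convergence _ _ _ nu _ measurableT
  (fun n x => (ln (a x + n.+1%:R^-1))%:E) (fun x => (ln (a x))%:E)
  (fun x => `|(ln (a x))%:E| + M%:E) mf.
- exact/measurable_EFinP.
- apply: filterS ae_pos_of_integrable_ln => x ax _.
  apply: cvg_EFin; first exact: nearW.
  apply: continuous_cvg; first exact: continuous_ln.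
  have := cvgD (cvg_cst (a x)) (@cvg_harmonic R).
  by rewrite addr0; apply.
- apply: integrableD => //.
    by apply: integrable_abse; exact: integrable_ln.
  exact: finite_measure_integrable_cst.
- apply: filterS ae_pos_of_integrable_ln => x ax n _.
  have h0 : (0 <= n.+1%:R^-1 :> R)%R by rewrite invr_ge0.
  have h1 : (n.+1%:R^-1 <= 1 :> R)%R by rewrite invf_le1 ?ltr0n// ler1n.
  have M0 : (0 <= M)%R := le_trans (a0 x) (aM x).
  rewrite -EFinD lee_fin ler_norml; apply/andP; split.
    apply: (@le_trans _ _ (ln (a x))); last first.
      by rewrite ler_ln ?posrE ?lerDl// ltr_wpDr.
    by rewrite lerNl (le_trans (ler_norm _))// normrN lerDl.
  apply: (@le_trans _ _ (ln (1 + M))); last first.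
    by rewrite (le_trans (le_ln1Dx _))// ?lerDr// (lt_le_trans _ M0)// ltrN10.
  by rewrite ler_ln ?posrE ?ltr_wpDr// addrC lerD.
- by [].
Qed.

End log_limit.

(** * Transforms of the stable and quasi-Lebesgue measures *)

Section transforms.
Local Open Scope ereal_scope.
Context (R : realType) d (X : measurableType d) (nu : probability X R).
Implicit Types (a : X -> R) (P : probability (Dplus R X) R).

(** The scaling constant is such that its power [al] is [k ^ al / al]: the
    factor [1 / al] turns [a ^ al - 1] into a difference quotient at
    exponent 0. *)
Lemma stable_gamma_powR (k : {posnum R}) (al : R) : (0 < al)%R ->
  (stable_gamma k al `^ al = k%:num `^ al / al)%R.
Proof.
move=> al0; rewrite /stable_gamma powRM ?invr_ge0 ?powR_ge0// -powRN -powRrM.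
by rewrite mulNr mulVf ?gt_eqF// powR_inv1 // ltW.
Qed.

Lemma laplace_weight_scale c a eta : bounded_nonneg a ->
  laplace_weight a (Dplus_scale c eta) =
  laplace_weight (fun x => c%:num * a x)%R eta.
Proof.
move=> [ma a0 _]; rewrite /laplace_weight; congr (expR (- fine _)).
transitivity (c%:num%:E * \int[Dplus_val eta]_x (a x)%:E).
  apply: ge0_integral_mscale => //; first exact/measurable_EFinP.
  by move=> x _; rewrite lee_fin.
rewrite -ge0_integralZl_EFin//.
- by move=> x _; rewrite lee_fin.
- exact/measurable_EFinP.
Qed.

(** The mass [expR (stable_gamma k al `^ al)] supplies the term [- 1] in
    [(a x `^ al - 1) / al], since [nu] has total mass 1. *)
Lemma laplace_stable_check (k : {posnum R}) (al : R) P a :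
  (0 < al < 1)%R -> is_stable_law nu al P -> bounded_nonneg a ->
  laplace (stable_check k al P) a =
  (expR (- (k%:num `^ al *
    fine (\int[nu]_x ((a x `^ al - 1) / al)%:E))))%:E.
Proof.
move=> /andP[al0 al1] Pst ba.
pose c := NngNum (stable_gamma_ge0 k al).
have bca : bounded_nonneg (fun x => c%:num * a x)%R.
  exact: bounded_nonneg_scale.
have bpa := bounded_nonneg_powR ba (ltW al0).
have ipa := bounded_nonneg_integrable nu bpa.
have fpa := integrable_fin_num measurableT ipa.
have caE x : ((c%:num * a x) `^ al = c%:num `^ al * a x `^ al)%R.
  by have [_ a0 _] := ba; rewrite powRM.
have int_ca : \int[nu]_x ((c%:num * a x) `^ al)%:E =
    (c%:num `^ al * fine (\int[nu]_x (a x `^ al)%:E))%:E.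
  rewrite EFinM fineK//; under eq_integral do rewrite caE EFinM.
  by rewrite integralZl.
have -> : laplace (stable_check k al P) a =
    (expR (c%:num `^ al))%:E * laplace P (fun x => c%:num * a x)%R.
  rewrite !laplaceE//.
  transitivity (\int[stable_tilde k al P]_eta
      (laplace_weight (fun x => c%:num * a x)%R eta)%:E).
    transitivity (\int[pushforward (stable_tilde k al P) (Dplus_scale c)]_eta
        (laplace_weight a eta)%:E).
      by apply: eq_measure_integral => //; exact: measurable_Dplus_scale.
    rewrite ge0_integral_pushforward//.
    - by rewrite preimage_setT; apply: eq_integral => eta _ /=;
         rewrite laplace_weight_scale.
    - exact: measurable_Dplus_scale.
    - by apply/measurable_EFinP; exact: measurable_laplace_weight.
    - by move=> eta _; rewrite lee_fin ltW// laplace_weight_gt0.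
  rewrite ge0_integral_mscale//.
  - by apply/measurable_EFinP; exact: measurable_laplace_weight.
  - by move=> eta _; rewrite lee_fin ltW// laplace_weight_gt0.
have [mca ca0 _] := bca.
rewrite Pst//; last by rewrite int_ca ltry.
rewrite int_ca -EFinN /= -EFinM -expRD; congr (expR _)%:E.
have -> : \int[nu]_x ((a x `^ al - 1) / al)%:E =
    ((fine (\int[nu]_x (a x `^ al)%:E) - 1) / al)%:E.
  under eq_integral do rewrite mulrC EFinM EFinB.
  rewrite integralZl//; last first.
    apply: integrableB => //; exact: finite_measure_integrable_cst.
  rewrite integralB_EFin//; last exact: finite_measure_integrable_cst.
  rewrite integral_cst// [X in 1 * X](@probability_setT _ _ _ nu) mule1.
  by rewrite mulrC EFinM EFinB fineK.
rewrite /= /c/= stable_gamma_powR//; ring.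
Qed.

Lemma laplace_stable_check_cvg (k : {posnum R})
    (P : R -> probability (Dplus R X) R) a :
  (forall al, (0 < al < 1)%R -> is_stable_law nu al (P al)) ->
  bounded_nonneg a -> \int[nu]_x `|lne (a x)%:E| < +oo ->
  laplace (stable_check k al (P al)) a @[al --> 0^'+] -->
    (expR (- fine (\int[nu]_x (ln (a x))%:E)))%:E.
Proof.
move=> Pst ba la.
pose J al := fine (\int[nu]_x ((a x `^ al - 1) / al)%:E).
apply: (@cvg_trans _ ((expR (- (k%:num `^ al * J al)))%:E @[al --> 0^'+])).
  apply: near_eq_cvg; near=> al; apply/esym/laplace_stable_check => //.
    by apply/andP; split; near: al;
      [exact: nbhs_right_gt|exact: nbhs_right_lt].
  apply: Pst.
    by apply/andP; split; near: al;
      [exact: nbhs_right_gt|exact: nbhs_right_lt].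
apply: cvg_EFin; first exact: nearW.
apply: continuous_cvg; first exact: continuous_expR.
apply: cvgN.
have fln : \int[nu]_x (ln (a x))%:E \is a fin_num.
  exact/(integrable_fin_num measurableT)/integrable_ln.
have cJ : J al @[al --> 0^'+] --> fine (\int[nu]_x (ln (a x))%:E).
  by apply: fine_cvg; rewrite fineK//; exact: cvg_integral_powR_ln.
have kpos : (0 < k%:num)%R by [].
by have := cvgM (cvg_powR_at0 kpos) cJ; rewrite mul1r; apply.
Unshelve. all: by end_near. Qed.

Lemma integral_quasi_lebesgue P (f : Dplus R X -> \bar R) :
  measurable_fun [set: Dplus R X] f -> (forall eta, 0 <= f eta) ->
  \int[quasi_lebesgue P]_eta f eta =
  \int[P]_eta (f eta * (expR (fine (Dplus_val eta [set: X])))%:E).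
Proof.
move=> mf f0.
apply: (@integral_density _ _ _ P _
  (fun eta : Dplus R X => expR (fine (Dplus_val eta [set: X])))) => //.
- apply: measurableT_comp => //; apply: measurableT_comp => //.
  exact: measurable_Dplus_ev.
- move=> A mA; apply: eq_integral => eta _.
  by rewrite -[in LHS](@fineK _ (Dplus_val eta [set: X])) ?fin_num_measure.
Qed.

(** The density [exp (eta X)] lowers the test function by 1; above 1 it stays
    nonnegative, where the law of the gamma process is prescribed. *)
Lemma laplace_quasi_lebesgue_ge1 P a :
  is_gamma_law nu P -> bounded_nonneg a -> (forall x, 1 <= a x)%R ->
  laplace (quasi_lebesgue P) a = expeR (- \int[nu]_x (ln (a x))%:E).
Proof.
move=> Pg ba a1.
have ba1 : bounded_nonneg (fun x => a x - 1)%R by exact: bounded_nonnegB.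
transitivity (laplace P (fun x => a x - 1)%R); last first.
  rewrite Pg//; congr (expeR (- _)); apply: eq_integral => x _.
  by rewrite addrC subrK.
rewrite !laplaceE// integral_quasi_lebesgue; last 2 first.
- by apply/measurable_EFinP; exact: measurable_laplace_weight.
- by move=> eta; rewrite lee_fin ltW// laplace_weight_gt0.
apply: eq_integral => eta _; rewrite -EFinM; congr _%:E.
have := @laplace_weight_sub _ _ _ a 1 eta 1 ba ler01.
rewrite mulr1 expr1 => ->//; congr (_ * _)%R.
by rewrite laplace_weight_cst mul1r -expRN opprK.
Qed.

End transforms.

(** * Identification below 1 *)

Section extension.
Local Open Scope ereal_scope.
Context (R : realType) d (X : measurableType d) (nu : probability X R).
Variables (k : {posnum R}) (P : R -> probability (Dplus R X) R).
Hypothesis Pst :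
  forall al, (0 < al < 1)%R -> is_stable_law nu al (P al).
Variable Pg : probability (Dplus R X) R.
Hypothesis PgP : is_gamma_law nu Pg.
Implicit Types a : X -> R.

Lemma integral_lne_lty a (e : R) : bounded_nonneg a -> (0 < e)%R ->
  (forall x, e <= a x)%R -> \int[nu]_x `|lne (a x)%:E| < +oo.
Proof.
move=> [ma a0 [M aM]] e0 ea.
have ax x : (0 < a x)%R := lt_le_trans e0 (ea x).
have : \int[nu]_x (`|ln e| + `|M|)%:E < +oo.
  by rewrite integral_cst// [X in _ * X](@probability_setT _ _ _ nu) mule1 ltry.
apply: le_lt_trans; apply: ge0_le_integral => //.
- under eq_fun do rewrite lne_EFin//.
  do 2 apply: measurableT_comp => //.
  exact: (measurableT_comp (@measurable_ln R) ma).
- move=> x _; rewrite lne_EFin// lee_fin ler_norml; apply/andP; split.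
    apply: (@le_trans _ _ (ln e)); last by rewrite ler_ln ?posrE.
    by rewrite lerNl (le_trans (ler_norm _))// normrN lerDl.
  apply: (le_trans (ltW (ln_sublinear (ax x)))).
  by rewrite (le_trans (aM x))// (le_trans (ler_norm M))// lerDr.
Qed.

(** Starting from test functions above 1, each use of [laplace_extension] lowers
    the admissible threshold by [c = e / 2], as long as the function stays above
    [2 * c] so that [a - c] is again bounded away from 0.  The converging family
    is that of the stable processes, whose transforms are known at every
    positive test function. *)
Lemma laplace_quasi_lebesgue_ge a (e : R) : bounded_nonneg a -> (0 < e)%R ->
  (forall x, e <= a x)%R ->
  laplace (quasi_lebesgue Pg) a = (expR (- fine (\int[nu]_x (ln (a x))%:E)))%:E.
Proof.
move=> ba e0 ea; pose c : R := (e / 2)%R.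
have c0 : (0 < c)%R by rewrite divr_gt0.
have c2 : (2 * c = e)%R by rewrite /c mulrC divfK// pnatr_eq0.
suff S n b : bounded_nonneg b -> (forall x, 2 * c <= b x)%R ->
    (forall x, 1 - n%:R * c <= b x)%R ->
    laplace (quasi_lebesgue Pg) b =
      (expR (- fine (\int[nu]_x (ln (b x))%:E)))%:E.
  have [n cn] : exists n, (c^-1 <= n%:R)%R.
    by exists (Num.bound c^-1); apply/ltW/archi_boundP; rewrite invr_ge0 ltW.
  apply: (S n) => // x; first by rewrite c2.
  apply: le_trans (ltW (lt_le_trans e0 (ea x))).
  by rewrite subr_le0 -ler_pdivrMr// div1r.
elim: n b => [|n IH] b bb cb nb.
  have b1 x : (1 <= b x)%R by rewrite (le_trans _ (nb x))// mul0r subr0.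
  rewrite (laplace_quasi_lebesgue_ge1 PgP bb b1).
  have /(integrable_fin_num measurableT)/fineK <- := integrable_ln bb
    (integral_lne_lty bb ltr01 b1).
  by [].
have cle x (y : R) : (0 <= y -> 2 * c <= b x + y)%R.
  by move=> y0; rewrite (le_trans (cb x))// lerDl.
have jc0 j : (0 <= j%:R * c)%R by rewrite mulr_ge0// ltW.
have c20 : (0 < 2 * c)%R by rewrite mulr_gt0.
have cc x : (c <= b x - c)%R.
  by rewrite lerBrDr (le_trans _ (cb x))// mulrDl mul1r.
have bD j : bounded_nonneg (fun x => b x + j.+1%:R * c)%R.
  by apply: bounded_nonnegD => //; exact: bounded_nonneg_cst.
apply: (@laplace_extension _ _ _ _ 0^'+ _
  (fun al => stable_check k al (P al)) (quasi_lebesgue Pg) b c _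
  (expR (- fine (\int[nu]_x (ln (b x - c))%:E)))
  (fun j => expR (- fine (\int[nu]_x (ln (b x + j.+1%:R * c))%:E)))) => //.
- move=> j; apply: laplace_stable_check_cvg => //.
  by apply: (integral_lne_lty (bD j) c20) => x; exact: cle.
- move=> j; apply: IH => // x; first exact: cle.
  rewrite lerBlDr -addrA -mulrDl (le_trans (_ : 1 <= b x + n.+1%:R * c)%R)//.
    by rewrite -lerBlDr.
  by rewrite lerD2l ler_wpM2r ?(ltW c0)// -natrD ler_nat addSn ltnS leq_addl.
- apply: laplace_stable_check_cvg => //.
  exact: (integral_lne_lty bb c20).
- have bB : bounded_nonneg (fun x => b x - c)%R.
    apply: bounded_nonnegB => //; first exact: ltW.
    by move=> x; rewrite (le_trans (cc x))// gerBl ltW.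
  apply: laplace_stable_check_cvg => //.
  exact: (integral_lne_lty bB c0).
Qed.

(** Approximating [a] by [a + 1 / n.+1]: monotone convergence for the transform,
    dominated convergence for the logarithm. *)
Lemma laplace_quasi_lebesgueE a : bounded_nonneg a ->
  \int[nu]_x `|lne (a x)%:E| < +oo ->
  laplace (quasi_lebesgue Pg) a = (expR (- fine (\int[nu]_x (ln (a x))%:E)))%:E.
Proof.
move=> ba la; pose h n : R := (n.+1%:R^-1)%R.
have h0 n : (0 < h n)%R by rewrite invr_gt0.
have bah n : bounded_nonneg (fun x => a x + h n)%R.
  by apply: bounded_nonnegD => //; apply/bounded_nonneg_cst/ltW.
have fln : \int[nu]_x (ln (a x))%:E \is a fin_num.
  exact/(integrable_fin_num measurableT)/integrable_ln.
have cR : laplace (quasi_lebesgue Pg) (fun x => a x + h n)%R @[n --> \oo] -->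
    (expR (- fine (\int[nu]_x (ln (a x))%:E)))%:E.
  under eq_fun => n.
    rewrite (laplace_quasi_lebesgue_ge (bah n) (h0 n)); last first.
      by move=> x; rewrite lerDr; have [_ + _] := ba; exact.
    over.
  apply: cvg_EFin; first exact: nearW.
  apply: continuous_cvg; first exact: continuous_expR.
  by apply: cvgN; apply: fine_cvg; rewrite fineK//; exact: cvg_integral_ln_add.
have hc n : bounded_nonneg (fun _ : X => h n) by apply/bounded_nonneg_cst/ltW.
have cL : laplace (quasi_lebesgue Pg) (fun x => a x + h n)%R @[n --> \oo] -->
    laplace (quasi_lebesgue Pg) a.
  under eq_fun do rewrite laplaceE//.
  rewrite laplaceE// (_ : \int[_]_eta (laplace_weight a eta)%:E =
    \int[quasi_lebesgue Pg]_eta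
      limn (fun n => (laplace_weight (fun x => a x + h n)%R eta)%:E)).
    apply: cvg_monotone_convergence => //.
    - by move=> n; apply/measurable_EFinP; exact: measurable_laplace_weight.
    - by move=> n eta _; rewrite lee_fin ltW// laplace_weight_gt0.
    - move=> eta _ m n mn; rewrite lee_fin !laplace_weightD//.
      rewrite ler_wpM2l// ?(ltW (laplace_weight_gt0 _ _))//.
      rewrite !laplace_weight_cst ler_expR lerN2 ler_wpM2r ?fine_ge0//.
      by rewrite lef_pV2 ?posrE ?ltr0n// ler_nat.
  apply: eq_integral => eta _; apply/esym/cvg_lim => //.
  apply: cvg_EFin; first exact: nearW.
  under eq_fun do rewrite laplace_weightD// laplace_weight_cst.
  have hM : (h n * fine (Dplus_val eta [set: X]))%R @[n --> \oo] -->
      (0 * fine (Dplus_val eta [set: X]))%R.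
    by apply: cvgM; [exact: cvg_harmonic|exact: cvg_cst].
  have eM : expR (- (h n * fine (Dplus_val eta [set: X])))%R @[n --> \oo] -->
      expR (- (0 * fine (Dplus_val eta [set: X])))%R.
    by apply: continuous_cvg; [exact: continuous_expR|exact: cvgN].
  have := cvgM (cvg_cst (laplace_weight a eta)) eM.
  by rewrite mul0r oppr0 expR0 mulr1; apply.
exact: (cvg_unique _ cL cR).
Qed.

End extension.

Unset Implicit Arguments.
Set Strict Implicit.
Set Printing Implicit Defensive.

Theorem corollary7 (R : realType) (d : measure_display) (X : measurableType d)
    (nu : probability X R) (X_borel : standard_borel R X)
    (nu_nonatomic : nonatomic nu) (k : {posnum R})
    (P_stable : R -> probability (Dplus R X) R)
    (P_stableP : forall alpha : R, 0 < alpha < 1 ->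
      is_stable_law nu alpha (P_stable alpha))
    (P_gamma : probability (Dplus R X) R)
    (P_gammaP : is_gamma_law nu P_gamma) :
  laplace_cvg nu 0^'+ (fun alpha : R => stable_check k alpha (P_stable alpha))
    (quasi_lebesgue P_gamma).
Proof.
move=> a ba la; rewrite (laplace_quasi_lebesgueE k P_stableP P_gammaP ba la).
exact: laplace_stable_check_cvg.
Qed.
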